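(* Let $X$ and $Y$ be locally compact complete path-metric spaces, let $L\ge1$, and suppose $(f_j)$ is a sequence of $L$-BLD-mappings $X\to Y$ converging pointwise to a continuous discrete mapping $f\colon X\to Y$. Then $f$ is $L$-BLD.
   Context: A path is a continuous map on $[0,1]$; $\ell(\gamma)\in[0,\infty]$ is its length. A metric space $(X,d)$ is a path-metric space if $d(x,y)$ is the infimum of lengths of paths from $x$ to $y$, for all $x,y\in X$. A mapping is discrete if all point inverses are discrete sets; a branched cover is a continuous, discrete and open mapping. $f\colon X\to Y$ is $L$-BLD if it is a branched cover and $L^{-1}\ell(\gamma)\le\ell(f\circ\gamma)\le L\,\ell(\gamma)$ for all paths $\gamma\colon[0,1]\to X$. *)

(* Defs.v *)
From HB Require Import structures.
From mathcomp Require Import all_boot all_order all_algebra.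
From mathcomp Require Import all_classical all_reals all_analysis.

Set Implicit Arguments.
Unset Strict Implicit.
Unset Printing Implicit Defensive.

Import Order.TTheory GRing.Theory Num.Theory.
Import numFieldNormedType.Exports.

Local Open Scope classical_set_scope.
Local Open Scope ring_scope.

(* Completeness as in [Uniform_isComplete], without requiring a chosen point. *)
Definition complete_space (T : uniformType) : Prop :=
  forall F : set_system T, ProperFilter F -> cauchy F ->
    exists x : T, F --> x.

(* A path is a map on all of R of which only the restriction to [0, 1] counts;
   any map defined on [0, 1] alone has such an extension. *)
Definition is_path (R : realType) (T : topologicalType) (g : R -> T) : Prop :=
  {within `[0, 1], continuous g}.

(* The analogue of [variation], for maps into a metric space:
   a :: s lists the points of a partition of [a, b]. *)
Definition mvariation (R : realType) (T : metricType R) (a b : R)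
    (g : R -> T) (s : seq R) : R :=
  let G := g \o nth b (a :: s) in
  \sum_(0 <= n < size s) mdist (G n) (G n.+1).

Definition path_length (R : realType) (T : metricType R) (g : R -> T) : \bar R :=
  ereal_sup [set (mvariation 0 1 g s)%:E | s in itv_partition 0 1].

(* When no path joins x to y the infimum is +oo, so the equality fails. *)
Definition path_metric_space (R : realType) (T : metricType R) : Prop :=
  forall x y : T,
    (mdist x y)%:E =
    ereal_inf [set path_length g | g in
      [set g : R -> T | [/\ is_path g, g 0 = x & g 1 = y]]].

Definition discrete_set (T : topologicalType) (A : set T) : Prop :=
  A `<=` isolated A.

Definition discrete_map (S T : topologicalType) (f : S -> T) : Prop :=
  forall y : T, discrete_set (f @^-1` [set y]).

Definition open_map (S T : topologicalType) (f : S -> T) : Prop :=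
  forall U : set S, open U -> open (f @` U).

Definition branched_cover (S T : topologicalType) (f : S -> T) : Prop :=
  [/\ continuous f, discrete_map f & open_map f].

Definition is_BLD (R : realType) (S T : metricType R) (L : R) (f : S -> T) :
    Prop :=
  branched_cover f /\
  forall g : R -> S, is_path g ->
    ((L^-1)%:E * path_length g <= path_length (f \o g))%E /\
    (path_length (f \o g) <= L%:E * path_length g)%E.

(* Main.v *)
(* Co-Lipschitz estimates pass to the limit, and discreteness turns them back
   into the lower bound on lengths. More precisely:
   - Each [f_ j] is L-co-Lipschitz on compact balls: a short path from [f_ j x]
     to [y] is lifted from [x], and by the BLD inequality the lift is at most L
     times as long. The lift is made of local lifts, each of which is an
     ultralimit of discrete ones: over the grid of mesh 1/n one moves in the
     preimage of the path along chains with steps < 1/n, which exist because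
     [f_ j] is open, and which cannot leave a small ball before the path does
     because [f_ j] is discrete.
   - By compactness of small balls, [f] is L-co-Lipschitz as well, hence open.
   - Since the fibres of [f] are discrete, this forces, for [w] near [x],
     d(x, w) <= L d(f x, f w); along a path such an inequality around each point
     adds up to the lower length bound. *)
Require Import Defs.
From mathcomp Require Import all_boot all_order all_algebra.
From mathcomp Require Import all_classical all_reals all_analysis.
From mathcomp Require Import lra.

Set Implicit Arguments.
Unset Strict Implicit.
Unset Printing Implicit Defensive.

Import Order.TTheory GRing.Theory Num.Theory.
Import numFieldNormedType.Exports.

Local Open Scope classical_set_scope.
Local Open Scope ring_scope.

(** * Induction along a real interval *)

(** The supremum of the points of [[a, b]] satisfying [P] satisfies [P] by the limit clause, and the
    step clause forbids it to lie below [b]. *)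
Lemma real_induction (R : realType) (a b : R) (P : R -> Prop) :
  a <= b -> P a ->
  (forall s, a <= s -> s < b -> P s -> exists s', [/\ s < s', s' <= b & P s']) ->
  (forall s, a < s -> s <= b ->
    (forall e, 0 < e -> exists s', [/\ a <= s', s - e < s', s' < s & P s']) ->
    P s) ->
  P b.
Proof.
move=> ab Pa step lim.
pose E := [set s | a <= s <= b /\ P s].
have Ea : E a by split=> //; rewrite lexx.
have supE : has_sup E.
  by split; [exists a | exists b => s [/andP[]]].
set c := sup E.
have ac : a <= c by apply: ub_le_sup => //; exact: supE.2.
have cb : c <= b by apply: ge_sup; [exists a | move=> s [/andP[]]].
have Pc : P c.
  have [ca|] := leP c a; first by have -> : c = a by apply/le_anti/andP.
  (* If [P c] fails, the points of [E] close to [c] lie strictly below it, as the limit clause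
     asks. *)
  move=> a_c; apply: contrapT => nPc.
  apply: (nPc); apply: lim => // e e0.
  have [s [/andP[as_ sb] Ps] es] := sup_adherent e0 supE.
  have sc : s <= c.
    by apply: ub_le_sup; [exact: supE.2 | split=> //; rewrite as_ sb].
  exists s; split=> //; rewrite lt_neqAle sc andbT.
  by apply/eqP => sE; apply: nPc; rewrite -sE.
have [bc|c_b] := leP b c; first by have -> : b = c by apply/le_anti/andP.
have [s [cs sb Ps]] := step c ac c_b Pc.
have : s <= c.
  apply: ub_le_sup; first exact: supE.2.
  by split=> //; rewrite sb (le_trans ac (ltW cs)).
by rewrite leNgt cs.
Qed.

(** * Variation over partitions and length *)

Lemma mvariationE (R : realType) (T : metricType R) (a b : R) (g : R -> T) s :
  mvariation a b g s = \sum_(d <- pairmap (fun u v => mdist (g u) (g v)) a s) d.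
Proof.
rewrite /mvariation [RHS](big_nth 0) size_pairmap !big_mkord.
by apply: eq_bigr => i _; rewrite /= (nth_pairmap b).
Qed.

Lemma mvariation_cat (R : realType) (T : metricType R) (a c b : R) (g : R -> T)
    s t : itv_partition a c s ->
  mvariation a b g (s ++ t) = mvariation a c g s + mvariation c b g t.
Proof.
by move=> [_ /eqP sc]; rewrite !mvariationE pairmap_cat big_cat/= sc.
Qed.

Lemma mvariation1 (R : realType) (T : metricType R) (a b : R) (g : R -> T) :
  mvariation a b g [:: b] = mdist (g a) (g b).
Proof. by rewrite mvariationE/= big_seq1. Qed.

Lemma mvariation_cons (R : realType) (T : metricType R) (a b c : R) (g : R -> T)
    s : mvariation a b g (c :: s) = mdist (g a) (g c) + mvariation c b g s.
Proof. by rewrite !mvariationE/= big_cons. Qed.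

Lemma mdist_le_path_length (R : realType) (T : metricType R) (g : R -> T) :
  ((mdist (g 0) (g 1))%:E <= path_length g)%E.
Proof.
apply: ereal_sup_ubound; exists [:: 1]; last by rewrite mvariation1.
by apply: itv_partition1.
Qed.

(** The partition on the right may depend on the one on the left, which leaves room for
    refinement. *)
Lemma path_lengthM (R : realType) (S T : metricType R) (C : R) (g : R -> S)
    (h : R -> T) : 0 < C ->
  (forall s, itv_partition 0 1 s -> exists2 s', itv_partition 0 1 s' &
     mvariation 0 1 g s <= C * mvariation 0 1 h s') ->
  (path_length g <= C%:E * path_length h)%E.
Proof.
move=> C0 gh; apply: ge_ereal_sup => _ [s /gh[s' s'P ss'] <-].
apply: (@le_trans _ _ (C%:E * (mvariation 0 1 h s')%:E)%E).
  by rewrite -EFinM lee_fin.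
rewrite lee_pmul2l// ?lte_fin//.
by apply: ereal_sup_ubound; exists s'.
Qed.

Lemma lipschitz_path_length (R : realType) (S T : metricType R) (L : R)
    (f : S -> T) (g : R -> S) : 0 < L ->
  (forall x y, mdist (f x) (f y) <= L * mdist x y) ->
  (path_length (f \o g) <= L%:E * path_length g)%E.
Proof.
move=> L0 fL; apply: path_lengthM => // s sP; exists s => //.
have H a b : mvariation a b (f \o g) s <= L * mvariation a b g s.
  rewrite !mvariationE; elim: s a {sP} => [|c s ih] a /=.
    by rewrite !big_nil mulr0.
  by rewrite !big_cons mulrDr lerD.
exact: H.
Qed.

(** Since [path_length] only measures [[0, 1]], a partition almost realising the length of the
    rescaled path is carried over to [[a, b]] by the affine map. *)
Lemma path_length_affine (R : realType) (T : metricType R) (g : R -> T)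
    (a b d : R) : a < b ->
  (d%:E <= path_length (fun u => g (a + (b - a) * u)%R))%E ->
  forall e, 0 < e -> exists2 s, itv_partition a b s & d - e < mvariation a b g s.
Proof.
move=> ab dg e e0.
have : ((d - e)%:E < path_length (fun u => g (a + (b - a) * u)%R))%E.
  by apply: lt_le_trans dg; rewrite lte_fin; lra.
move=> /ereal_sup_gt[_ [s [ps /eqP ls] <-]]; rewrite lte_fin => ds.
pose h u := a + (b - a) * u.
have h0 : h 0 = a by rewrite /h; lra.
have h1 : h 1 = b by rewrite /h; lra.
exists (map h s).
  split; last by rewrite -[in last _]h0 last_map ls h1.
  rewrite -[X in path _ X]h0; apply: homo_path ps => u v uv.
  by rewrite /h ltrD2l ltr_pM2l ?subr_gt0.
apply: (lt_le_trans ds); rewrite !mvariationE.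
suff H u : pairmap (fun u v => mdist (g u) (g v)) (h u) (map h s) =
    pairmap (fun u v => mdist (g (h u)) (g (h v))) u s.
  by rewrite -[X in pairmap _ X (map h s)]h0 H.
by elim: s u {ps ls ds} => //= c s ih u; rewrite ih.
Qed.

(** * Limits along ultrafilters *)

Lemma fmap_ultra (S T : Type) (u : S -> T) (U : set_system S) :
  UltraFilter U -> UltraFilter (u @ U).
Proof.
move=> UU; split=> [|G GG sUG]; first exact: fmap_proper_filter.
apply/seteqP; split=> // A GA; have [//|UnA] := in_ultra_setVsetC (u @^-1` A) UU.
have GnA : G (~` A) by apply: sUG.
by have /filter_ex[x []] : G (A `&` ~` A) by exact: filterI.
Qed.

(** Replaces the extraction of subsequences: one ultrafilter serves for all times [t] of a path at
    once. *)
Lemma compact_ultra_cvg (S : Type) (T : topologicalType) (K : set T)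
    (U : set_system S) (u : S -> T) : UltraFilter U -> compact K ->
  (forall n, K (u n)) -> exists2 p, K p & u @ U --> p.
Proof.
move=> UU; rewrite compact_ultra => cK Ku.
have [|p [Kp up]] := cK (u @ U) (fmap_ultra u UU); last by exists p.
exact: (@filterE _ U _ (u @^-1` K)).
Qed.

(** * Balls, isolated points of fibres, continuity of paths *)

Lemma mdist_continuous (R : realType) (X : metricType R) (x : X) :
  continuous (mdist x : X -> R).
Proof.
move=> p; apply/cvgrPdist_lt => e e0.
apply/metricType_numDomainType.nbhs_mdistP; exists e => // q /= pq.
rewrite ltr_norml; apply/andP; split.
  by have := metric_triangle x p q; lra.
by have := metric_triangle x q p; rewrite (metric_sym q p); lra.
Qed.

Lemma closed_cball (R : realType) (X : metricType R) (x : X) (r : R) :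
  closed [set w | mdist x w <= r].
Proof.
by apply: preimage_closed (@closed_le _ r) => p _; exact: mdist_continuous.
Qed.

Lemma closed_outside_ball (R : realType) (X : metricType R) (x : X) (r : R) :
  closed [set w | r <= mdist x w].
Proof.
by apply: preimage_closed (@closed_ge _ r) => p _; exact: mdist_continuous.
Qed.

Lemma locally_compact_cball (R : realType) (X : metricType R) (x : X)
    (V : set X) : locally_compact [set: X] -> nbhs x V ->
  exists r, [/\ 0 < r, [set w | mdist x w <= r] `<=` V &
    compact [set w | mdist x w <= r]].
Proof.
move=> /(_ x I)[K xK [cK _]] xV.
have /metricType_numDomainType.nbhs_mdistP[r /= r0 rP] :
    nbhs x (V `&` K).
  apply: filterI => //; have : \forall w \near x, setT w -> K w := xK.
  by apply: filterS => w; exact.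
have sub (w : X) : mdist x w <= r / 2 -> (V `&` K) w.
  by move=> xw; apply: rP => /=; lra.
exists (r / 2); split; first by lra.
  by move=> w /sub[].
by apply: subclosed_compact cK _; [exact: closed_cball | move=> w /sub[]].
Qed.

Lemma discrete_map_isolated (R : realType) (X Y : metricType R) (f : X -> Y)
    (x : X) : discrete_map f ->
  exists2 r, 0 < r & forall w, f w = f x -> mdist x w < r -> w = x.
Proof.
move=> /(_ (f x) x erefl)[_ [V xV VE]].
have /metricType_numDomainType.nbhs_mdistP[r /= r0 rV] := xV.
exists r => // w fw xw; have : (V `&` f @^-1` [set f x]) w by split; [exact: rV|].
by rewrite VE.
Qed.

Lemma path_near (R : realType) (T : topologicalType) (g : R -> T) (t : R)
    (V : set T) : is_path g -> 0 <= t -> t <= 1 -> nbhs (g t) V ->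
  exists2 d, 0 < d & forall s, 0 <= s -> s <= 1 -> `|t - s| < d -> V (g s).
Proof.
move=> /subspace_continuousP gc t0 t1 gV.
have tI : `[0, 1]%classic t by rewrite /= in_itv/= t0.
have /nbhs_ballP[d /= d0 dP] := gc t tI V gV.
exists d => // s s0 s1 ts; apply: dP => //.
by rewrite in_itv/= s0.
Qed.

Lemma near_path (R : realType) (T : metricType R) (g : R -> T) :
  (forall t e, 0 <= t -> t <= 1 -> 0 < e -> exists2 d, 0 < d &
     forall s, 0 <= s -> s <= 1 -> `|t - s| < d -> mdist (g t) (g s) < e) ->
  is_path g.
Proof.
move=> H; apply/subspace_continuousP => t /=; rewrite in_itv/= => /andP[t0 t1].
apply/metricType_numDomainType.cvgrPdist_lt => e e0.
have [d d0 dP] := H t e t0 t1 e0.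
apply/nbhs_ballP; exists d => // s ts /=; rewrite in_itv/= => /andP[s0 s1].
exact: dP.
Qed.

Lemma path_cvg (R : realType) (S : Type) (U : set_system S) (T : topologicalType)
    (g : R -> T) (th : S -> R) (t : R) : Filter U ->
  is_path g -> 0 <= t -> t <= 1 -> (forall n, 0 <= th n <= 1) ->
  th @ U --> t -> g (th n) @[n --> U] --> g t.
Proof.
move=> FU gp t0 t1 th01 tht V gV; have [d d0 dP] := path_near gp t0 t1 gV.
have /cvgrPdist_lt/(_ d d0) := tht.
apply: filterS => n tn; have /andP[? ?] := th01 n; exact: dP.
Qed.

(** * Chains with small steps *)

(** The discrete substitute for a path in [P]. Only the points after [x] are asked to lie in [P]. *)
Inductive ichain (R : realType) (X : metricType R) (e : R) (P : set X) (x : X) :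
    X -> Prop :=
  | ichain_refl : ichain e P x x
  | ichain_step y z : ichain e P x y -> P z -> mdist y z < e -> ichain e P x z.

Lemma ichain_trans (R : realType) (X : metricType R) (e : R) (P : set X)
    (x y z : X) : ichain e P x y -> ichain e P y z -> ichain e P x z.
Proof.
by move=> xy; elim=> // u v _ xu Pv uv; apply: ichain_step xu Pv uv.
Qed.

Lemma ichainS (R : realType) (X : metricType R) (e : R) (P Q : set X) (x y : X) :
  P `<=` Q -> ichain e P x y -> ichain e Q x y.
Proof.
move=> PQ; elim=> [|u v _ xu /PQ Qv uv]; first exact: ichain_refl.
exact: ichain_step xu Qv uv.
Qed.

(** A step shorter than [r] that crosses the sphere of radius [r] about [p] has its outer end in the
    annulus between [r] and [2 * r], which [P] avoids. The equivalence serves chains followed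
    forward or backward in time. *)
Lemma ichain_trap (R : realType) (X : metricType R) (e r : R) (P : set X)
    (p x y : X) : e <= r -> P x ->
  (forall w, P w -> r <= mdist p w -> mdist p w <= 2 * r -> False) ->
  ichain e P x y -> mdist p x < r <-> mdist p y < r.
Proof.
move=> er Px annulus; suff H : ichain e P x y ->
  P y /\ (mdist p x < r <-> mdist p y < r) by move=> /H[].
elim=> [//|u v _ [Pu ->] Pv uv]; split=> //.
have tuv := metric_triangle p u v.
have tvu := metric_triangle p v u; rewrite (metric_sym v u) in tvu.
split=> lt_r; rewrite ltNge; apply/negP => ge_r.
  by apply: (annulus v) => //; lra.
by apply: (annulus u) => //; lra.
Qed.

(** * A free ultrafilter on the natural numbers *)

Lemma eventually_ultra :
  exists2 U : set_system nat, UltraFilter U & \oo `<=` U.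
Proof.
have [U [UU sU]] := ultraFilterLemma (F := \oo%classic) _.
by exists U.
Qed.

Lemma ultra_natSinv_lt (R : realType) (U : set_system nat) (e : R) :
  UltraFilter U -> \oo `<=` U -> 0 < e -> \forall n \near U, n.+1%:R^-1 < e.
Proof.
by move=> UU sU e0; apply: sU; exact: (near_infty_natSinv_lt (PosNum e0)).
Qed.

Lemma ultra_cvg_natSinv (R : realType) (U : set_system nat) (u : nat -> R)
    (t : R) : UltraFilter U -> \oo `<=` U ->
  (forall n, `|t - u n| < n.+1%:R^-1) -> u @ U --> t.
Proof.
move=> UU sU tu; apply/cvgrPdist_lt => e e0.
have := ultra_natSinv_lt UU sU e0.
by apply: filterS => n; apply: lt_trans.
Qed.

(** * Path lifting *)

(** Induction on the time reached: openness of [f] at a point interior to [K] gives the next step,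
    and compactness of [K] gives a point over a limit time. *)
Lemma ichain_advance (R : realType) (X Y : metricType R) (f : X -> Y)
    (b : R -> Y) (K : set X) (t t' e : R) (w : X) :
  continuous f -> open_map f -> is_path b -> compact K ->
  (forall s v, 0 <= s -> s <= 1 -> K v -> f v = b s -> nbhs v K) ->
  0 <= t -> t <= t' -> t' <= 1 -> 0 < e -> K w -> f w = b t ->
  exists w', [/\ K w', f w' = b t' &
    ichain e (K `&` f @^-1` (b @` `[t, t']%classic)) w w'].
Proof.
move=> fc fo bp cK inK t0 tt' t'1 e0 Kw fw.
apply: (real_induction (P := fun s => exists w', [/\ K w', f w' = b s &
    ichain e (K `&` f @^-1` (b @` `[t, t']%classic)) w w'])) tt' _ _ _.
- by exists w; split=> //; exact: ichain_refl.
- move=> s ts st' [v [Kv fv wv]].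
  have s0 := le_trans t0 ts; have s1 := le_trans (ltW st') t'1.
  (* The image of this neighbourhood contains [b s'] for [s'] slightly beyond [s], so one step
     shorter than [e] inside [K] reaches the fibre over [b s']. *)
  have vV : nbhs v (K `&` ball v e).
    by apply: filterI; [exact: inK fv | exact: nbhsx_ballx].
  have : nbhs (b s) (f @` (K `&` ball v e)).
    have : open_nbhs (b s) (f @` (K `&` ball v e)^°).
      split; first by apply: fo; exact: open_interior.
      by exists v.
    move=> /open_nbhs_nbhs; apply: filterS => _ [x xV <-].
    by exists x => //; exact: interior_subset xV.
  move=> /(path_near bp s0 s1)[d d0 dP].
  have [s' ss' [s't' s'd]] : exists2 s', s < s' & s' <= t' /\ s' < s + d.
    have [dt|dt] := leP (s + d / 2) t'; first by exists (s + d / 2); [|split]; lra.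
    by exists t' => //; split; lra.
  exists s'; split=> //.
  have [||| x [Kx vx] fx] := dP s'; [lra|lra|by rewrite ltr_norml; apply/andP; split; lra|].
  exists x; split=> //; apply: ichain_step wv _ _; last first.
    by move: vx; rewrite ballEmdist.
  by split=> //; exists s' => //=; rewrite in_itv/= s't' andbT; lra.
- move=> s ts st' H.
  have n0 (n : nat) : 0 < n.+1%:R^-1 :> R by rewrite invr_gt0.
  have /choice[u uP] : forall n : nat, exists u : R * X, [/\ 0 <= u.1 <= 1,
      s - n.+1%:R^-1 < u.1 < s, K u.2, f u.2 = b u.1 &
      ichain e (K `&` f @^-1` (b @` `[t, t']%classic)) w u.2].
    move=> n; have [s' [ts' ns' s's [v [Kv fv wv]]]] := H _ (n0 n).
    by exists (s', v); rewrite /= ns' s's; split=> //; apply/andP; split; lra.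
  have [U UU sU] := eventually_ultra.
  have [|v Kv uv] := compact_ultra_cvg (u := fun n => (u n).2) UU cK.
    by move=> n; have [] := uP n.
  have us : (u n).1 @[n --> U] --> s.
    apply: ultra_cvg_natSinv => // n; have [_ /andP[nu us] _ _ _] := uP n.
    by rewrite distrC ltr_distl nu (lt_trans us)// ltrDl.
  have fv : f v = b s.
    apply: (@cvg_unique _ (@metric_hausdorff R Y) (f (u n).2 @[n --> U])).
      exact: cvg_comp uv (fc v).
    have -> : (fun n => f (u n).2) = (fun n => b (u n).1).
      by apply/funext => n; have [] := uP n.
    by apply: path_cvg => //; [lra | lra | move=> n; have [] := uP n].
  exists v; split=> //.
  (* A single chain ending within [e] of the limit [v] suffices: [v] is appended to it. *)
  have /metricType_numDomainType.cvgrPdist_lt/(_ e e0)/filter_ex[n vn] := uv.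
  have [_ _ _ _ wn] := uP n; apply: ichain_step wn _ _.
    by split=> //; exists s => //=; rewrite in_itv/= st' andbT ltW.
  by rewrite metric_sym.
Qed.

(** The points of the grid of mesh [n.+1%:R^-1] are reached one after another by [ichain_advance].
    The step function [g] lies exactly over [b] at the rounded time [th t]. *)
Lemma approximate_lift (R : realType) (X Y : metricType R) (f : X -> Y)
    (b : R -> Y) (K : set X) (z : X) (n : nat) :
  continuous f -> open_map f -> is_path b -> compact K ->
  (forall s v, 0 <= s -> s <= 1 -> K v -> f v = b s -> nbhs v K) ->
  K z -> f z = b 0 ->
  exists g : R -> X, exists th : R -> R, [/\ g 0 = z,
    forall t, 0 <= t -> t <= 1 -> [/\ 0 <= th t <= 1,
      `|t - th t| < n.+1%:R^-1, K (g t) & f (g t) = b (th t)] &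
    forall t t', 0 <= t -> t <= t' -> t' <= 1 ->
      th t <= th t' /\
      ichain n.+1%:R^-1 (K `&` f @^-1` (b @` `[th t, th t']%classic))
        (g t) (g t')].
Proof.
move=> fc fo bp cK inK Kz fz; set e : R := n.+1%:R^-1.
have e0 : 0 < e by rewrite invr_gt0.
have ne : n.+1%:R * e = 1 by rewrite mulfV// pnatr_eq0.
pose J (i j : nat) := K `&` f @^-1` (b @` `[i%:R * e, j%:R * e]%classic).
have JS i j k l : (k <= i)%N -> (j <= l)%N -> J i j `<=` J k l.
  move=> ki jl x [Kx [s]]; rewrite /= in_itv/= => /andP[is_ sj] sE.
  split=> //; exists s => //=; rewrite in_itv/=.
  by rewrite (le_trans _ is_) ?(le_trans sj)// ler_wpM2r ?ler_nat// ltW.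
(* The conditions stand behind implications so that [G] is total and can be iterated; where they
   fail, its value is irrelevant. *)
have /choice[G GP] : forall iw : nat * X, exists w', (iw.1 < n.+1)%N ->
    K iw.2 -> f iw.2 = b (iw.1%:R * e) ->
    [/\ K w', f w' = b (iw.1.+1%:R * e) & ichain e (J iw.1 iw.1.+1) iw.2 w'].
  move=> [i w] /=; have [Kw|nKw] := pselect (K w); last by exists w.
  have [fw|nfw] := pselect (f w = b (i%:R * e)); last by exists w.
  have [iN|Ni] := ltnP i n.+1; last by exists w.
  have [|||w' H] := ichain_advance (t := i%:R * e) (t' := i.+1%:R * e)
    fc fo bp cK inK _ _ _ e0 Kw fw.
  - by rewrite mulr_ge0// ltW.
  - by rewrite ler_wpM2r ?ler_nat// ltW.
  - by rewrite -[leRHS]ne ler_wpM2r ?ler_nat// ltW.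
  by exists w'.
pose sq := fix sq i := if i is j.+1 then G (j, sq j) else z.
have sqP i : (i <= n.+1)%N -> K (sq i) /\ f (sq i) = b (i%:R * e).
  elim: i => [_|i ih iN]; first by rewrite /= mul0r.
  by have [Ki fi] := ih (ltnW iN); have [] := GP (i, sq i) iN Ki fi.
have chain i j : (i <= j)%N -> (j <= n.+1)%N -> ichain e (J i j) (sq i) (sq j).
  elim: j => [|j ih]; first by rewrite leqn0 => /eqP -> _; exact: ichain_refl.
  rewrite leq_eqVlt => /orP[/eqP -> _|]; first exact: ichain_refl.
  rewrite ltnS => ij jN; have [Kj fj] := sqP j (ltnW jN).
  have [_ _ jj] := GP (j, sq j) jN Kj fj.
  apply: ichain_trans (ichainS _ jj); last exact: JS.
  by apply: ichainS (ih ij (ltnW jN)); apply: JS.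
(* The index of the grid cell containing [t]; [th] will round [t] down to the grid. *)
pose k (t : R) := Num.truncn (t * n.+1%:R).
have kP t : 0 <= t -> (k t)%:R * e <= t < (k t)%:R * e + e.
  move=> t0; have tN : 0 <= t * n.+1%:R by rewrite mulr_ge0.
  have /andP[lo hi] := truncn_itv tN.
  rewrite -[X in _ + X](mul1r e) -mulrDl natr1 /e.
  by rewrite ler_pdivrMr// ltr_pdivlMr// lo.
have kN t : 0 <= t -> t <= 1 -> (k t <= n.+1)%N.
  move=> t0 t1; have /andP[lo _] := kP t t0.
  by rewrite -(ler_nat R) -(ler_pM2r e0) ne; lra.
exists (fun t => sq (k t)), (fun t => (k t)%:R * e); split.
- by rewrite /k mul0r truncn0.
- move=> t t0 t1; have [? ?] := sqP _ (kN t t0 t1).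
  have /andP[lo hi] := kP t t0; split=> //.
    by rewrite (le_trans lo)// andbT mulr_ge0// ltW.
  by rewrite ger0_norm; lra.
- move=> t t' t0 tt' t'1.
  have kk : (k t <= k t')%N by apply: le_truncn; rewrite ler_wpM2r.
  split; first by rewrite ler_wpM2r ?ler_nat// ltW.
  by apply: chain; last by apply: kN => //; lra.
Qed.

(** The lift is the pointwise ultralimit of the approximate lifts. It lies over [b] since the
    rounded times converge to [t]; its continuity comes from trapping chains near the isolated point
    [g t] of its fibre. *)
Lemma path_lift (R : realType) (X Y : metricType R) (f : X -> Y)
    (b : R -> Y) (K : set X) (z : X) :
  branched_cover f -> is_path b -> compact K ->
  (forall s v, 0 <= s -> s <= 1 -> K v -> f v = b s -> nbhs v K) ->
  K z -> f z = b 0 ->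
  exists g : R -> X, [/\ is_path g, g 0 = z &
    forall t, 0 <= t -> t <= 1 -> f (g t) = b t].
Proof.
move=> [fc fd fo] bp cK inK Kz fz.
have /choice[h0 /choice[th hP]] := fun n =>
  approximate_lift n fc fo bp cK inK Kz fz.
(* Clamping the time to [[0, 1]] makes the ultralimit exist for every real [t]. *)
pose cl (t : R) := Num.max 0 (Num.min t 1).
have cl01 t : 0 <= cl t <= 1.
  by rewrite /cl le_max lexx/= ge_max ler01 ge_min lexx orbT.
have clE t : 0 <= t -> t <= 1 -> cl t = t.
  by move=> t0 t1; rewrite /cl min_l// max_r.
have [U UU sU] := eventually_ultra.
have /choice[g gP] : forall t, exists p, K p /\ h0 n (cl t) @[n --> U] --> p.
  move=> t; have /andP[c0 c1] := cl01 t.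
  have [|p Kp hp] := compact_ultra_cvg (u := fun n => h0 n (cl t)) UU cK.
    by move=> n; have [_ /(_ _ c0 c1)[]] := hP n.
  by exists p.
have gcvg t : 0 <= t -> t <= 1 -> h0 n t @[n --> U] --> g t.
  by move=> t0 t1; have [_] := gP t; rewrite clE.
have lift t : 0 <= t -> t <= 1 -> f (g t) = b t.
  move=> t0 t1.
  apply: (@cvg_unique _ (@metric_hausdorff R Y) (f (h0 n t) @[n --> U])).
    exact: cvg_comp (gcvg t t0 t1) (fc (g t)).
  have -> : (fun n => f (h0 n t)) = (fun n => b (th n t)).
    by apply/funext => n; have [_ /(_ _ t0 t1)[]] := hP n.
  apply: path_cvg => //; first by move=> n; have [_ /(_ _ t0 t1)[]] := hP n.
  by apply: ultra_cvg_natSinv => // n; have [_ /(_ _ t0 t1)[]] := hP n.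
exists g; split=> //; last first.
  apply: (@cvg_unique _ (@metric_hausdorff R X) (h0 n 0 @[n --> U])).
    exact: gcvg.
  have -> : (fun n => h0 n 0) = (fun=> z) by apply/funext => n; have [] := hP n.
  exact: cvg_cst.
apply: near_path => t eta t0 t1 eta0.
have [rho rho0 isol] := discrete_map_isolated (g t) fd.
(* [2 * r < rho] keeps the annulus where the fibre is isolated, and [r <= eta / 2] leaves room for
   the error [eta / 4] in passing to the limit. *)
pose r := Num.min (eta / 2) (rho / 3).
have r0 : 0 < r by rewrite lt_min; apply/andP; split; lra.
have [reta rrho] : r <= eta / 2 /\ r <= rho / 3.
  by split; rewrite /r ge_min lexx ?orbT.
(* A chain with small steps cannot cross the annulus [A], which avoids the
   fibre of [f] over [b t]. *)
pose A := K `&` ([set w | mdist (g t) w <= 2 * r] `&` [set w | r <= mdist (g t) w]).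
have cA : closed (f @` A).
  apply: compact_closed; first exact: metric_hausdorff.
  apply: continuous_compact; first exact: continuous_subspaceT.
  apply: compact_closedI => //.
  by apply: closedI; [exact: closed_cball|exact: closed_outside_ball].
have : nbhs (b t) (~` (f @` A)).
  apply: open_nbhs_nbhs; split; first by rewrite openC.
  move=> [w [Kw [/= w2r rw]]]; rewrite -lift// => /isol wE.
  by move: rw; rewrite wE ?mdistxx; lra.
move=> /(path_near bp t0 t1)[d d0 dP].
(* The other half of [d] absorbs the rounding of times to the grid. *)
exists (d / 2); first by lra.
move=> s s0 s1; rewrite ltr_norml => /andP[ts1 ts2].
suff close : \forall n \near U, mdist (g t) (h0 n s) < r.
  have r2 : 0 < eta / 4 by lra.
  have /metricType_numDomainType.cvgrPdist_lt/(_ _ r2) sn := gcvg s s0 s1.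
  have /filter_ex[n [/= n1 n2]] : \forall n \near U,
      mdist (g t) (h0 n s) < r /\ mdist (g s) (h0 n s) < eta / 4.
    by apply: filterS2 close sn.
  have := metric_triangle (g t) (h0 n s) (g s).
  by rewrite (metric_sym (h0 n s)); lra.
have /metricType_numDomainType.cvgrPdist_lt/(_ _ r0) tn := gcvg t t0 t1.
have d2 : 0 < Num.min (d / 2) r by rewrite lt_min r0 andbT; lra.
have nn := ultra_natSinv_lt UU sU d2.
apply: filterS2 tn nn => n tn; rewrite lt_min => /andP[nd nr].
have [_ hn chain] := hP n.
have trap u v : 0 <= u -> u <= v -> v <= 1 -> `|t - u| < d / 2 ->
    `|t - v| < d / 2 -> mdist (g t) (h0 n u) < r <-> mdist (g t) (h0 n v) < r.
  move=> u0 uv v1 tu tv; have [thuv ch] := chain u v u0 uv v1.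
  have [_ ut Ku fu] := hn u u0 (le_trans uv v1).
  have [_ vt _ _] := hn v (le_trans u0 uv) v1.
  have {}ut := lt_trans ut nd; have {}vt := lt_trans vt nd.
  apply: ichain_trap ch; first exact: ltW.
    by split=> //; exists (th n u); rewrite //= in_itv/= lexx.
  move=> w [Kw [q]] /=; rewrite in_itv/= => /andP[q1 q2] qw rw w2.
  have [/andP[? ?] _ _ _] := hn u u0 (le_trans uv v1).
  have [/andP[? ?] _ _ _] := hn v (le_trans u0 uv) v1.
  move: tu tv ut vt; rewrite !ltr_norml => /andP[? ?] /andP[? ?] /andP[? ?] /andP[? ?].
  apply: (dP q); [lra | lra | by rewrite ltr_norml; apply/andP; split; lra|].
  by exists w.
have tt : `|t - t| < d / 2 by rewrite subrr normr0; lra.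
have ts : `|t - s| < d / 2 by rewrite ltr_norml ts1 ts2.
have [st|/ltW t_s] := leP s t; first by apply/(trap s t).
by apply/(trap t s).
Qed.

(** * Lengths of pieces of paths, and co-Lipschitz continuity of BLD mappings *)

(** Says that [g] has length at least [d] on [[a, b]]. Working with partitions up to [e] makes such
    bounds add up over adjacent intervals without handling suprema. *)
Definition length_ge (R : realType) (T : metricType R) (g : R -> T)
    (a b d : R) : Prop :=
  forall e, 0 < e -> exists2 s, itv_partition a b s & d - e < mvariation a b g s.

Lemma length_ge_cat (R : realType) (T : metricType R) (g : R -> T)
    (a c b d d' : R) :
  length_ge g a c d -> length_ge g c b d' -> length_ge g a b (d + d').
Proof.
move=> gd gd' e e0; have e20 : 0 < e / 2 by lra.
have [s sP sd] := gd _ e20; have [s' sP' sd'] := gd' _ e20.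
exists (s ++ s'); first exact: itv_partition_cat sP sP'.
by rewrite (mvariation_cat _ _ _ sP); lra.
Qed.

Lemma length_geW (R : realType) (T : metricType R) (g : R -> T)
    (a b d d' : R) : d' <= d -> length_ge g a b d -> length_ge g a b d'.
Proof. by move=> dd' gd e e0; have [s sP sd] := gd e e0; exists s => //; lra. Qed.

Lemma length_ge0 (R : realType) (T : metricType R) (g : R -> T) (a b : R) :
  a <= b -> length_ge g a b 0.
Proof.
rewrite le_eqVlt => /predU1P[->|ab] e e0.
  by exists [::]; [split=> /= | rewrite mvariationE big_nil; lra].
exists [:: b]; first exact: itv_partition1.
by rewrite mvariation1; have := mdist_ge0 (g a) (g b); lra.
Qed.

Lemma length_ge_path_length (R : realType) (T : metricType R) (g : R -> T)
    (t c d : R) : t <= 1 -> length_ge g 0 t d -> (path_length g < c%:E)%E ->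
  d <= c.
Proof.
move=> t1 gd gc; apply/ler_addgt0Pr => e e0.
have [s sP sd] := length_ge_cat gd (length_ge0 g t1) e0.
have : ((mvariation 0 1 g s)%:E <= path_length g)%E.
  by apply: ereal_sup_ubound; exists s.
by move=> /le_lt_trans/(_ gc); rewrite lte_fin; lra.
Qed.

Lemma eq_path_length (R : realType) (T : metricType R) (g h : R -> T) :
  (forall t, 0 <= t -> t <= 1 -> g t = h t) -> path_length g = path_length h.
Proof.
move=> gh; rewrite /path_length; congr ereal_sup.
apply: eq_imagel => s sP; congr (_%:E); apply: eq_big_nat => i /andP[_ si].
by congr mdist; apply: gh;
  rewrite ?(itv_partition_nth_ge _ sP) ?(itv_partition_nth_le _ sP)// ltnS ltnW.
Qed.

Lemma path_affine (R : realType) (T : metricType R) (g : R -> T) (a b : R) :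
  0 <= a -> a <= b -> b <= 1 -> is_path g ->
  is_path (fun u => g (a + (b - a) * u)).
Proof.
move=> a0 ab b1 gp.
have h01 u : 0 <= u -> u <= 1 -> 0 <= a + (b - a) * u <= 1.
  by move=> u0 u1; apply/andP; split; nra.
apply: near_path => t e t0 t1 e0; have /andP[h0 h1] := h01 t t0 t1.
have [d d0 dP] := path_near gp h0 h1 (nbhsx_ballx (g (a + (b - a) * t)) e e0).
exists d => // s s0 s1 ts; have /andP[hs0 hs1] := h01 s s0 s1.
have := dP _ hs0 hs1; rewrite ballEmdist; apply.
have -> : a + (b - a) * t - (a + (b - a) * s) = (b - a) * (t - s) by lra.
rewrite normrM (le_lt_trans _ ts)// ger0_norm ?subr_ge0//.
by rewrite ler_piMl//; lra.
Qed.

(** A small compact sphere about [z] misses the fibre of [z], so its image stays away from [g] just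
    after [a]. A short piece of [g] thus lifts inside the ball, and the BLD inequality bounds the
    distance between the ends of the lift. *)
Lemma BLD_lift_step (R : realType) (X Y : metricType R) (L : R) (f : X -> Y)
    (g : R -> Y) (a : R) (z : X) :
  locally_compact [set: X] -> 0 < L -> is_BLD L f -> is_path g ->
  0 <= a -> a < 1 -> f z = g a ->
  exists a', [/\ a < a', a' <= 1 &
    exists z', f z' = g a' /\ length_ge g a a' (mdist z z' / L)].
Proof.
move=> lcX L0 [bf BLD] gp a0 a1 fz; have [fc fd fo] := bf.
have [rho rho0 isol] := discrete_map_isolated z fd.
have [r [r0 rrho cK]] := locally_compact_cball lcX (nbhsx_ballx z rho rho0).
pose K := [set w | mdist z w <= r].
pose S := K `&` [set w | r <= mdist z w].
have cS : closed (f @` S).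
  apply: compact_closed; first exact: metric_hausdorff.
  apply: continuous_compact; first exact: continuous_subspaceT.
  by apply: compact_closedI => //; exact: closed_outside_ball.
have : nbhs (g a) (~` (f @` S)).
  apply: open_nbhs_nbhs; split; first by rewrite openC.
  move=> [w [Kw /= rw]]; rewrite -fz => /isol wE.
  have := rrho _ Kw; rewrite ballEmdist => /wE wz.
  by move: rw; rewrite wz mdistxx; lra.
move=> /(path_near gp a0 (ltW a1))[d d0 dP].
have [a' aa' [a'1 a'd]] : exists2 a', a < a' & a' <= 1 /\ a' < a + d.
  have [ad|ad] := leP (a + d / 2) 1; first by exists (a + d / 2); [|split]; lra.
  by exists 1 => //; split; lra.
exists a'; split=> //.
pose h u := g (a + (a' - a) * u).
have hp : is_path h by apply: path_affine => //; lra.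
(* Over this piece no point of [K] lies on the sphere [S], so each is in the open ball. *)
have inK s v : 0 <= s -> s <= 1 -> K v -> f v = h s -> nbhs v K.
  move=> s0 s1 Kv fv; have [zv|vz] := ltP (mdist z v) r.
    apply/metricType_numDomainType.nbhs_mdistP.
    exists (r - mdist z v) => /=; first by lra.
    by move=> w /= vw; have := metric_triangle z v w; rewrite /K/=; lra.
  exfalso; apply: (dP (a + (a' - a) * s)); [by nra|by nra| |by exists v].
  by rewrite ltr_norml; apply/andP; split; nra.
have [||G [Gp G0 Gl]] := path_lift bf hp cK inK (z := z).
- by rewrite /= mdistxx ltW.
- by rewrite /h mulr0 addr0.
have h1 : h 1 = g a' by rewrite /h mulr1; congr g; lra.
exists (G 1); split; first by rewrite Gl.
apply: path_length_affine => //; rewrite -(eq_path_length Gl).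
have [+ _] := BLD G Gp; apply: le_trans.
rewrite mulrC EFinM lee_wpmul2l// ?lee_fin ?invr_ge0 ?(ltW L0)// -G0.
exact: mdist_le_path_length.
Qed.

(** A path from [f x] to [y] shorter than [r / L] is followed to its end. Only the endpoint [z] of a
    lift is tracked, its distance to [x] being charged to the length of [g] used so far; hence local
    lifts are never glued. *)
Lemma BLD_coLipschitz (R : realType) (X Y : metricType R) (L r : R)
    (f : X -> Y) (x : X) (y : Y) :
  locally_compact [set: X] -> path_metric_space Y -> 0 < L -> is_BLD L f ->
  compact [set w | mdist x w <= r] -> L * mdist (f x) y < r ->
  exists2 x', mdist x x' <= r & f x' = y.
Proof.
move=> lcX pmY L0 BLD cK xyr.
have : ((mdist (f x) y)%:E < (r / L)%:E)%E.
  by rewrite lte_fin ltr_pdivlMr// mulrC.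
rewrite pmY => /ereal_inf_lt[_ [g [gp g0 g1] <-]] gL.
(* The length budget keeps every tracked endpoint in the compact ball, where limits exist. *)
have inK t z : t <= 1 -> length_ge g 0 t (mdist x z / L) -> mdist x z <= r.
  move=> t1 /(length_ge_path_length t1)/(_ gL).
  by rewrite ler_pdivrMr// divfK// gt_eqF.
suff [z [fz zl]] : exists z, f z = g 1 /\ length_ge g 0 1 (mdist x z / L).
  by exists z; [exact: inK zl | rewrite fz].
apply: (real_induction (P := fun t => exists z, f z = g t /\
    length_ge g 0 t (mdist x z / L)) ler01).
- by exists x; rewrite mdistxx mul0r; split=> //; exact: length_ge0.
- move=> s s0 s1 [z [fz zl]].
  have [s' [ss' s'1 [z' [fz' zl']]]] := BLD_lift_step lcX L0 BLD gp s0 s1 fz.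
  exists s'; split=> //; exists z'; split=> //.
  apply: length_geW (length_ge_cat zl zl').
  by rewrite -mulrDl ler_pM2r ?invr_gt0// metric_triangle.
- move=> s s0 s1 H.
  have n0 (n : nat) : 0 < n.+1%:R^-1 :> R by rewrite invr_gt0.
  have /choice[u uP] : forall n : nat, exists u : R * X, [/\ 0 <= u.1 <= 1,
      s - n.+1%:R^-1 < u.1 < s, f u.2 = g u.1 &
      length_ge g 0 u.1 (mdist x u.2 / L)].
    move=> n; have [s' [s'0 ns' s's [v [fv vl]]]] := H _ (n0 n).
    by exists (s', v); rewrite /= ns' s's; split=> //; apply/andP; split; lra.
  have [U UU sU] := eventually_ultra.
  have [|z Kz uz] := compact_ultra_cvg (u := fun n => (u n).2) UU cK.
    by move=> n; have [/andP[_ u1] _ _] := uP n; exact: inK.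
  have us : (u n).1 @[n --> U] --> s.
    apply: ultra_cvg_natSinv => // n; have [_ /andP[nu us] _ _] := uP n.
    by rewrite distrC ltr_distl nu (lt_trans us)// ltrDl.
  have [[fc _ _] _] := BLD.
  exists z; split.
    apply: (@cvg_unique _ (@metric_hausdorff R Y) (f (u n).2 @[n --> U])).
      exact: cvg_comp uz (fc z).
    have -> : (fun n => f (u n).2) = (fun n => g (u n).1).
      by apply/funext => n; have [] := uP n.
    by apply: path_cvg => //; [lra | move=> n; have [] := uP n].
  (* Half of [e] pays for replacing [z] by a nearby [(u n).2], the other half for the choice of
     partition. *)
  move=> e e0; have eL : 0 < e / 2 * L by rewrite mulr_gt0//; lra.
  have /metricType_numDomainType.cvgrPdist_lt/(_ _ eL)/filter_ex[n zn] := uz.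
  have [_ /andP[_ /ltW us'] _ ul] := uP n.
  have e2 : 0 < e / 2 by lra.
  have [p pP pl] := length_ge_cat ul (length_ge0 g us') e2.
  exists p => //; apply: le_lt_trans pl; rewrite addr0.
  suff : mdist x z / L <= mdist x (u n).2 / L + e / 2 by lra.
  rewrite ler_pdivrMr// mulrDl divfK ?gt_eqF//.
  have := metric_triangle x (u n).2 z; rewrite (metric_sym (u n).2); lra.
Qed.

(** * Lipschitz bound and radial lower bound *)

Lemma BLD_lipschitz (R : realType) (X Y : metricType R) (L : R) (f : X -> Y)
    (x y : X) : path_metric_space X -> 0 < L -> is_BLD L f ->
  mdist (f x) (f y) <= L * mdist x y.
Proof.
move=> pmX L0 [_ BLD]; rewrite -ler_pdivrMl// -lee_fin pmX.
apply: le_ereal_inf_tmp => _ [g [gp <- <-] <-].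
rewrite EFinM -(@lee_pmul2l _ L%:E)// ?lte_fin// muleA -EFinM mulfV ?gt_eqF//.
rewrite mul1r; apply: le_trans (BLD g gp).2.
exact: mdist_le_path_length.
Qed.

(* The fibre of [f] through [x] is isolated at [x], so the point that
   co-Lipschitz continuity finds near [w] in this fibre is [x] itself. *)
Lemma coLipschitz_radial (R : realType) (X Y : metricType R) (L : R)
    (f : X -> Y) (x : X) :
  locally_compact [set: X] -> 0 < L -> discrete_map f ->
  (forall x y r, compact [set w | mdist x w <= r] -> L * mdist (f x) y < r ->
    exists2 x', mdist x x' <= r & f x' = y) ->
  exists2 r, 0 < r &
    forall w, mdist x w < r -> mdist x w <= L * mdist (f x) (f w).
Proof.
move=> lcX L0 fd coL; have [rho rho0 isol] := discrete_map_isolated x fd.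
have [r [r0 rrho cK]] := locally_compact_cball lcX (nbhsx_ballx x rho rho0).
(* With [r / 2], a ball about [w] of radius less than [mdist x w] stays in the compact ball about
   [x]. *)
exists (r / 2) => [|w xw]; first by lra.
rewrite leNgt; apply/negP => Lw.
(* The midpoint is large enough for [coL] to apply and too small for the ball about [w] to contain
   [x]. *)
pose q := (mdist x w + L * mdist (f x) (f w)) / 2.
have qw : q < mdist x w by rewrite /q; lra.
have cw : compact [set v | mdist w v <= q].
  apply: subclosed_compact cK _; first exact: closed_cball.
  by move=> v /=; have := metric_triangle x w v; lra.
have [|x' wx' fx'] := coL w (f x) q cw.
  by rewrite (metric_sym (f w)) /q; lra.
have xx' : x' = x.
  apply: isol => //; have : ball x rho x'.
    by apply: rrho => /=; have := metric_triangle x w x'; lra.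
  by rewrite ballEmdist.
by move: wx'; rewrite xx' (metric_sym w); lra.
Qed.

(** * Lower length bound from radial estimates *)

(** The radius in [radial] varies with the centre, so partition points are added by real induction:
    the new interval is estimated from its left end in the step clause, from its right end in the
    limit clause. *)
Lemma radial_mvariation (R : realType) (X Y : metricType R) (L : R)
    (f : X -> Y) (g : R -> X) (a b : R) :
  (forall x, exists2 r, 0 < r &
    forall w, mdist x w < r -> mdist x w <= L * mdist (f x) (f w)) ->
  is_path g -> 0 <= a -> a <= b -> b <= 1 ->
  exists2 s, itv_partition a b s &
    mdist (g a) (g b) <= L * mvariation a b (f \o g) s.
Proof.
move=> radial gp a0 ab b1.
have near s : 0 <= s -> s <= 1 -> exists2 d, 0 < d & forall t, 0 <= t -> t <= 1 ->
    `|s - t| < d -> mdist (g s) (g t) <= L * mdist (f (g s)) (f (g t)).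
  move=> s0 s1; have [r r0 rP] := radial (g s).
  have [d d0 dP] := path_near gp s0 s1 (nbhsx_ballx (g s) r r0).
  by exists d => // t t0 t1 st; apply: rP; have := dP t t0 t1 st; rewrite ballEmdist.
have extend s t p : s < t -> itv_partition a s p ->
    mdist (g a) (g s) <= L * mvariation a s (f \o g) p ->
    mdist (g s) (g t) <= L * mdist (f (g s)) (f (g t)) ->
    exists2 p', itv_partition a t p' &
      mdist (g a) (g t) <= L * mvariation a t (f \o g) p'.
  move=> st ps gs gst; exists (p ++ [:: t]).
    by apply: itv_partition_cat ps _; exact: itv_partition1.
  rewrite (mvariation_cat _ _ _ ps) mvariation1 /= mulrDr.
  by have := metric_triangle (g a) (g s) (g t); lra.
apply: (real_induction (P := fun t => exists2 s, itv_partition a t s &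
    mdist (g a) (g t) <= L * mvariation a t (f \o g) s) ab).
- by exists [::]; [split=> /= | rewrite mdistxx mvariationE big_nil mulr0].
- move=> s as_ sb [p ps gs].
  have s0 : 0 <= s by lra.
  have s1 : s <= 1 by lra.
  have [d d0 dP] := near s s0 s1.
  have [t st [tb td]] : exists2 t, s < t & t <= b /\ t < s + d.
    have [sd|sd] := leP (s + d / 2) b; first by exists (s + d / 2); [|split]; lra.
    by exists b => //; split; lra.
  exists t; split=> //; apply: (extend _ _ _ st ps gs).
  by apply: dP; [lra|lra|rewrite ltr_norml; apply/andP; split; lra].
- move=> s as_ sb H.
  have s0 : 0 <= s by lra.
  have s1 : s <= 1 by lra.
  have [d d0 dP] := near s s0 s1.
  have [t [at_ st ts [p pt gt]]] := H d d0.
  apply: (extend _ _ _ ts pt gt).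
  rewrite metric_sym (metric_sym (f (g t))).
  by apply: dP; [lra|lra|rewrite ltr_norml; apply/andP; split; lra].
Qed.

(** Each interval of a partition is refined by [radial_mvariation], and the refinements are
    concatenated. *)
Lemma radial_path_length (R : realType) (X Y : metricType R) (L : R)
    (f : X -> Y) (g : R -> X) : 0 < L ->
  (forall x, exists2 r, 0 < r &
    forall w, mdist x w < r -> mdist x w <= L * mdist (f x) (f w)) ->
  is_path g -> (path_length g <= L%:E * path_length (f \o g))%E.
Proof.
move=> L0 radial gp; apply: path_lengthM => // s.
suff H a : 0 <= a -> itv_partition a 1 s -> exists2 s', itv_partition a 1 s' &
    mvariation a 1 g s <= L * mvariation a 1 (f \o g) s' by exact: H.
elim: s a => [|c s ih] a a0 sP.
  by exists [::] => //; rewrite !mvariationE !big_nil mulr0.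
have c1 := itv_partition_le (itv_partition_cons sP).
have /= ac : a < c by move: sP => [/= /andP[]].
have [p pP gp'] := radial_mvariation radial gp a0 (ltW ac) c1.
have [q qP gq] := ih c (le_trans a0 (ltW ac)) (itv_partition_cons sP).
exists (p ++ q); first exact: itv_partition_cat pP qP.
by rewrite mvariation_cons (mvariation_cat _ _ _ pP) mulrDr lerD.
Qed.

(** * Openness and pointwise limits *)

(** The image of a compact closed [r]-ball contains the open ball of radius [r / L] about the image
    of its centre. *)
Lemma coLipschitz_open (R : realType) (X Y : metricType R) (L : R)
    (f : X -> Y) :
  locally_compact [set: X] -> 0 < L ->
  (forall x y r, compact [set w | mdist x w <= r] -> L * mdist (f x) y < r ->
    exists2 x', mdist x x' <= r & f x' = y) ->
  open_map f.
Proof.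
move=> lcX L0 coL V oV; rewrite openE => _ [x Vx <-].
have [r [r0 rV cK]] := locally_compact_cball lcX (open_nbhs_nbhs (conj oV Vx)).
apply/metricType_numDomainType.nbhs_mdistP.
exists (r / L) => /=; first by rewrite divr_gt0.
move=> y /=; rewrite ltr_pdivlMr// mulrC => /(coL x y r cK)[x' xx' <-].
by exists x' => //; exact: rV.
Qed.

(** Preimages [u j] of [y] under [f_ j] have an ultralimit [p] in the compact ball. The common
    Lipschitz constant makes pointwise convergence at [p] enough for [f p = y]. *)
Lemma coLipschitz_lim (R : realType) (X Y : metricType R) (L : R)
    (f_ : nat -> X -> Y) (f : X -> Y) (x : X) (y : Y) (r : R) :
  0 < L -> (forall x, f_ j x @[j --> \oo] --> f x) ->
  (forall j x y, mdist (f_ j x) (f_ j y) <= L * mdist x y) ->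
  (forall j x y r, compact [set w | mdist x w <= r] ->
    L * mdist (f_ j x) y < r -> exists2 x', mdist x x' <= r & f_ j x' = y) ->
  compact [set w | mdist x w <= r] -> L * mdist (f x) y < r ->
  exists2 x', mdist x x' <= r & f x' = y.
Proof.
move=> L0 f_cvg lip coL cK xyr.
have r0 : 0 <= r.
  by apply/ltW; apply: le_lt_trans xyr; rewrite mulr_ge0// ?(ltW L0)// mdist_ge0.
(* While [f_ j x] is still too far from [y], [x] serves as a default. *)
have /choice[u uP] : forall j, exists x', mdist x x' <= r /\
    (L * mdist (f_ j x) y < r -> f_ j x' = y).
  move=> j; have [ltr|ger] := ltP (L * mdist (f_ j x) y) r.
    by have [x' xx' fx'] := coL j x y r cK ltr; exists x'.
  by exists x; rewrite mdistxx; split=> //; rewrite ltNge ger.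
have [U UU sU] := eventually_ultra.
have [|p Kp up] := compact_ultra_cvg (u := u) UU cK.
  by move=> j; have [] := uP j.
exists p => //; apply: mdist_positivity; apply/le_anti/andP; split.
  apply/ler_addgt0Pr => e e0; rewrite add0r.
  have e2 : 0 < e / 2 by lra.
  have eL : 0 < e / 2 / L by rewrite divr_gt0.
  (* Once [f_ j x] is this close to [f x], the inequality [L * mdist (f_ j x) y < r] holds as
     well. *)
  have gap : 0 < (r - L * mdist (f x) y) / L by rewrite divr_gt0//; lra.
  have /metricType_numDomainType.cvgrPdist_lt/(_ _ eL) up' := up.
  have /metricType_numDomainType.cvgrPdist_lt/(_ _ e2)/sU fp := f_cvg p.
  have /metricType_numDomainType.cvgrPdist_lt/(_ _ gap)/sU fx := f_cvg x.
  have /filter_ex[j [pu [fpj fxj]]] : \forall j \near U,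
      mdist p (u j) < e / 2 / L /\ mdist (f p) (f_ j p) < e / 2 /\
      mdist (f x) (f_ j x) < (r - L * mdist (f x) y) / L.
    by apply: filterS3 up' fp fx => j.
  have [_ fu] := uP j.
  have {}fu : f_ j (u j) = y.
    apply: fu; move: fxj; rewrite ltr_pdivlMr//.
    have := metric_triangle (f_ j x) (f x) y; rewrite (metric_sym (f_ j x) (f x)).
    by rewrite -(ler_pM2l L0) mulrDr; lra.
  have := metric_triangle (f p) (f_ j p) y; rewrite -{2}fu.
  have := lip j p (u j); move: pu; rewrite ltr_pdivlMr//; lra.
exact: mdist_ge0.
Qed.

Unset Implicit Arguments.

Theorem corollary1p3 (R : realType) (X Y : metricType R)
  (lcX : locally_compact [set: X]) (cX : complete_space X)
  (pmX : path_metric_space X)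
  (lcY : locally_compact [set: Y]) (cY : complete_space Y)
  (pmY : path_metric_space Y)
  (L : R) (L1 : 1 <= L)
  (f_ : nat -> X -> Y) (BLDf_ : forall j : nat, is_BLD L (f_ j))
  (f : X -> Y) (f_cvg : forall x : X, f_ j x @[j --> \oo] --> f x)
  (f_cont : continuous f) (f_discrete : discrete_map f) :
  is_BLD L f.
Proof.
have L0 : 0 < L by lra.
have lip j x y : mdist (f_ j x) (f_ j y) <= L * mdist x y.
  exact: BLD_lipschitz pmX L0 (BLDf_ j).
have coL x y r : compact [set w | mdist x w <= r] -> L * mdist (f x) y < r ->
    exists2 x', mdist x x' <= r & f x' = y.
  apply: (coLipschitz_lim L0 f_cvg lip) => j {}x {}y {}r.
  exact: BLD_coLipschitz lcX pmY L0 (BLDf_ j).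
split; first by split=> //; exact: coLipschitz_open lcX L0 coL.
move=> g gp; split.
  (* Multiplied by [L], the lower bound becomes the form given by the radial estimates. *)
  rewrite -(@lee_pmul2l _ L%:E) ?lte_fin// muleA -EFinM mulfV ?gt_eqF// mul1e.
  apply: radial_path_length => // x.
  exact: coLipschitz_radial lcX L0 f_discrete coL.
(* The upper bound holds since [f], as a pointwise limit of [L]-Lipschitz mappings, is
   [L]-Lipschitz. *)
apply: lipschitz_path_length => // x y; apply/ler_addgt0Pr => e e0.
have e2 : 0 < e / 2 by lra.
have /metricType_numDomainType.cvgrPdist_lt/(_ _ e2) fx := f_cvg x.
have /metricType_numDomainType.cvgrPdist_lt/(_ _ e2) fy := f_cvg y.
have /filter_ex[j [xj yj]] : \forall j \near \oo,
    mdist (f x) (f_ j x) < e / 2 /\ mdist (f y) (f_ j y) < e / 2.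
  by apply: filterS2 fx fy.
have := metric_triangle (f x) (f_ j x) (f y).
have := metric_triangle (f_ j x) (f_ j y) (f y).
by rewrite (metric_sym (f_ j y) (f y)); have := lip j x y; lra.
Qed.
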